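(* Let $\mathcal{C}$ be a small strict monoidal Ab-category with braiding $c$, let $S_0$ be an infinite set, and let $\mathcal{C}^{S_0}$ be the associated monoidal category (defined in the context). For objects $f,g$ of $\mathcal{C}^{S_0}$ let $C_{f,g}:f\otimes g\to g\otimes f$ be given by $$C_{f,g}(\gamma(x,y),\gamma(y',x'))=\delta_{x,x'}\delta_{y,y'}\,c_{f(x),g(y)}:f(x)\otimes g(y)\to g(y')\otimes f(x')$$ for $x,x'\in S_f$, $y,y'\in S_g$. Then the family $C$ of isomorphisms $C_{f,g}$ is a braiding in the category $\mathcal{C}^{S_0}$.
   Context: An Ab-category is a category whose hom-sets are additive abelian groups with bilinear composition; in a monoidal Ab-category the tensor product of morphisms is also assumed bilinear. The category $\mathcal{C}^{S_0}$. Objects are functions $f:S_f\to \mathrm{Obj}(\mathcal{C})$ with $S_f\subset S_0$ any subset. A morphism $F:f\to g$ is a function on $S_f\times S_g$ assigning to $(x,y)$ a morphism $F(x,y):f(x)\to g(y)$ of $\mathcal{C}$ such that, if $S_g$ is infinite, for each $x\in S_f$ there is a finite set $S^F_x\subset S_g$ with $F(x,y)=0$ for $y\in S_g\setminus S_x^F$. Composition is $(G\circ F)(x,y)=\sum_{z\in S_g}G(z,y)\circ F(x,z)$; identities are $\mathrm{Id}_f(x,y)=\delta_{x,y}\mathrm{id}_{f(x)}$ (here and throughout, $\delta$ times a morphism means that morphism when the indices agree and the zero morphism otherwise). Monoidal structure. Fix a bijection $\gamma:S_0\times S_0\to S_0$ and a point $\ast\in S_0$. For objects $f,g$, $f\otimes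 g:\gamma(S_f\times S_g)\to\mathrm{Obj}(\mathcal{C})$ is $(f\otimes g)(\gamma(x,y))=f(x)\otimes g(y)$. The unit object is $\mathrm{I}:\{\ast\}\to \mathrm{Obj}(\mathcal{C})$, $\ast\mapsto \mathrm{I}$. For morphisms $F:f\to f'$, $G:g\to g'$, $(F\otimes G)(\gamma(x,y),\gamma(x',y'))=F(x,x')\otimes G(y,y')$. The associativity constraint $A_{f,g,h}:(f\otimes g)\otimes h\to f\otimes(g\otimes h)$ is $A_{f,g,h}(\gamma(\gamma(x,y),z),\gamma(x',\gamma(y',z')))=\delta_{x,x'}\delta_{y,y'}\delta_{z,z'}\mathrm{id}_{f(x)\otimes g(y)\otimes h(z)}$; the units $R_f:f\otimes\mathrm{I}\to f$, $L_f:\mathrm{I}\otimes f\to f$ are $R_f(\gamma(x,\ast),x')=\delta_{x,x'}\mathrm{id}_{f(x)}$ and $L_f(\gamma(\ast,x),x')=\delta_{x,x'}\mathrm{id}_{f(x)}$. A braiding in a monoidal category is a natural family of isomorphisms $C_{f,g}:f\otimes g\to g\otimes f$ satisfying the two hexagon axioms. *)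

(* Defs.v *)
From HB Require Import structures.
From mathcomp Require Import all_boot ssralg finmap.
From mathcomp Require Import boolp classical_sets functions cardinality fsbigop.

Set Implicit Arguments.
Unset Strict Implicit.
Unset Printing Implicit Defensive.

Import GRing.Theory.
Local Open Scope classical_set_scope.
Local Open Scope ring_scope.

Declare Scope cat_scope.
Delimit Scope cat_scope with cat.
Local Open Scope cat_scope.

(** Categories, with [comp g f] standing for "g after f". *)

Record category := Category {
  obj :> Type;
  hom : obj -> obj -> Type;
  idc : forall a, hom a a;
  comp : forall a b c, hom b c -> hom a b -> hom a c;
  comp1m : forall a b (f : hom a b), comp (idc b) f = f;
  compm1 : forall a b (f : hom a b), comp f (idc a) = f;
  compA : forall a b c d (h : hom c d) (g : hom b c) (f : hom a b),
    comp h (comp g f) = comp (comp h g) f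
}.
Arguments hom {_} _ _ : simpl never.
Arguments idc {_} _ : simpl never.
Arguments comp {_ _ _ _} _ _ : simpl never.
Notation "g ∘ f" := (comp g f) (at level 40, left associativity) : cat_scope.

Definition inverses (C : category) (a b : C) (f : hom a b) (g : hom b a) :=
  g ∘ f = idc a /\ f ∘ g = idc b.

Definition is_iso (C : category) (a b : C) (f : hom a b) :=
  exists g, inverses f g.

(** The identity of [a], seen as a morphism to an object equal to [a]. *)
Definition eqhom (C : category) (a b : C) (e : a = b) : hom a b :=
  match e in _ = b' return hom a b' with erefl => idc a end.

Class monoidal (C : category) := Monoidal {
  unit_ob : C;
  tens : C -> C -> C;
  tensm : forall a a' b b', hom a a' -> hom b b' -> hom (tens a b) (tens a' b');
  assoc : forall a b c, hom (tens (tens a b) c) (tens a (tens b c));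
  associ : forall a b c, hom (tens a (tens b c)) (tens (tens a b) c);
  runit : forall a, hom (tens a unit_ob) a;
  lunit : forall a, hom (tens unit_ob a) a;
  tensm1 : forall a b, tensm (idc a) (idc b) = idc (tens a b);
  tensm_comp : forall a a' a'' b b' b'' (f' : hom a' a'') (f : hom a a')
      (g' : hom b' b'') (g : hom b b'),
    tensm (f' ∘ f) (g' ∘ g) = tensm f' g' ∘ tensm f g;
  assoc_nat : forall a a' b b' c c'
      (f : hom a a') (g : hom b b') (h : hom c c'),
    assoc a' b' c' ∘ tensm (tensm f g) h = tensm f (tensm g h) ∘ assoc a b c;
  runit_nat : forall a a' (f : hom a a'),
    runit a' ∘ tensm f (idc unit_ob) = f ∘ runit a;
  lunit_nat : forall a a' (f : hom a a'),
    lunit a' ∘ tensm (idc unit_ob) f = f ∘ lunit a;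
  assocK : forall a b c, inverses (assoc a b c) (associ a b c);
  runit_iso : forall a, is_iso (runit a);
  lunit_iso : forall a, is_iso (lunit a);
  pentagon : forall a b c d,
    assoc a b (tens c d) ∘ assoc (tens a b) c d =
    tensm (idc a) (assoc b c d) ∘ assoc a (tens b c) d
      ∘ tensm (assoc a b c) (idc d);
  triangle : forall a b,
    tensm (idc a) (lunit b) ∘ assoc a unit_ob b = tensm (runit a) (idc b)
}.
Arguments unit_ob {_ _}.
Arguments tens {_ _} _ _.
Arguments tensm {_ _ _ _ _ _} _ _.
Arguments assoc {_ _} _ _ _.
Arguments associ {_ _} _ _ _.
Arguments runit {_ _} _.
Arguments lunit {_ _} _.
Notation "a ⊗ b" := (tens a b) (at level 39, left associativity) : cat_scope.
Notation "f ⊗m g" := (tensm f g) (at level 39, left associativity) : cat_scope.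

Record strict (C : category) (M : monoidal C) : Prop := Strict {
  tensA : forall a b c : C, (a ⊗ b) ⊗ c = a ⊗ (b ⊗ c);
  tens1 : forall a : C, a ⊗ unit_ob = a;
  tens1o : forall a : C, unit_ob ⊗ a = a;
  assocE : forall a b c : C, assoc a b c = eqhom (tensA a b c);
  runitE : forall a : C, runit a = eqhom (tens1 a);
  lunitE : forall a : C, lunit a = eqhom (tens1o a)
}.

Record braiding (C : category) (M : monoidal C)
    (c : forall a b : C, hom (a ⊗ b) (b ⊗ a)) : Prop := Braiding {
  braid_iso : forall a b, is_iso (c a b);
  braid_nat : forall a a' b b' (f : hom a a') (g : hom b b'),
    c a' b' ∘ (f ⊗m g) = (g ⊗m f) ∘ c a b;
  hexagon1 : forall x y z,
    assoc y z x ∘ c x (y ⊗ z) ∘ assoc x y z =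
    (idc y ⊗m c x z) ∘ assoc y x z ∘ (c x y ⊗m idc z);
  hexagon2 : forall x y z,
    associ z x y ∘ c (x ⊗ y) z ∘ associ x y z =
    (c x z ⊗m idc y) ∘ associ x z y ∘ (idc x ⊗m c y z)
}.

Record abCategory := AbCategory {
  ab_obj : Type;
  ab_hom : ab_obj -> ab_obj -> zmodType;
  ab_id : forall a, ab_hom a a;
  ab_comp : forall a b c, ab_hom b c -> ab_hom a b -> ab_hom a c;
  ab_comp1m : forall a b (f : ab_hom a b), ab_comp (ab_id b) f = f;
  ab_compm1 : forall a b (f : ab_hom a b), ab_comp f (ab_id a) = f;
  ab_compA : forall a b c d
      (h : ab_hom c d) (g : ab_hom b c) (f : ab_hom a b),
    ab_comp h (ab_comp g f) = ab_comp (ab_comp h g) f;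
  ab_compDl : forall a b c (g g' : ab_hom b c) (f : ab_hom a b),
    ab_comp (g + g') f = ab_comp g f + ab_comp g' f;
  ab_compDr : forall a b c (g : ab_hom b c) (f f' : ab_hom a b),
    ab_comp g (f + f') = ab_comp g f + ab_comp g f'
}.

Coercion cat_of_ab (C : abCategory) : category :=
  Category (@ab_comp1m C) (@ab_compm1 C) (@ab_compA C).

Record monoidal_ab (C : abCategory) (M : monoidal C) : Prop := MonoidalAb {
  tensmDl : forall (a a' b b' : C) (f f' : hom a a') (g : hom b b'),
    (f + f') ⊗m g = f ⊗m g + f' ⊗m g;
  tensmDr : forall (a a' b b' : C) (f : hom a a') (g g' : hom b b'),
    f ⊗m (g + g') = f ⊗m g + f ⊗m g'
}.

(** [δ · m], where the target of [m] may only make sense as such because the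
    indices agree: [m] takes the proof of that as an argument. *)
Definition delta (C : abCategory) (P : Prop) (a b : C) (m : P -> hom a b)
  : hom a b :=
  match pselect P with left h => m h | right _ => 0 end.

Section Matrices.
Variables (C : abCategory) (S0 : choiceType).

Record matobj := MatObj { dom : set S0; fam :> dom -> C }.

Record mathom (f g : matobj) := MatHom {
  entry :> forall (x : dom f) (y : dom g), hom (f x) (g y);
  row_finite : infinite_set (dom g) -> forall x : dom f,
    exists2 B : set (dom g), finite_set B & forall y, ~ B y -> entry x y = 0
}.

Lemma mathom_ext (f g : matobj) (F G : mathom f g) :
  (forall x y, F x y = G x y) -> F = G.
Proof.
case: F G => [F hF] [G hG] /= FG.
have E : F = G by apply: functional_extensionality_dep => x;
  apply: functional_extensionality_dep => y; exact: FG.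
by subst G; congr MatHom; exact: Prop_irrelevance.
Qed.

Lemma row_seq (f g : matobj) (F : mathom f g) (x : dom f) :
  exists2 s : seq (dom g), uniq s & forall y, y \notin s -> F x y = 0.
Proof.
have [B finB FB] : exists2 B : set (dom g),
    finite_set B & forall y, ~ B y -> F x y = 0.
  have [fin|inf] := pselect (finite_set (dom g)); last exact: row_finite.
  exists setT; last by move=> y [].
  by rewrite (eq_finite_set (card_setT _)).
exists (fset_set B); first exact: fset_uniq.
move=> y; rewrite in_fset_set // => /negP yB; apply: FB.
by move=> By; apply: yB; rewrite inE.
Qed.

Lemma seq_row_finite (f g : matobj)
    (F : forall (x : dom f) (y : dom g), hom (f x) (g y)) :
  (forall x, exists s : seq (dom g), forall y, y \notin s -> F x y = 0) ->
  infinite_set (dom g) -> forall x : dom f,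
  exists2 B : set (dom g), finite_set B & forall y, ~ B y -> F x y = 0.
Proof.
move=> H _ x; have [s sF] := H x.
exists [set` s]; first exact: finite_seq.
by move=> y /negP ys; apply: sF.
Qed.

Lemma delta0 (P : Prop) (a b : C) (m : P -> hom a b) : ~ P -> delta m = 0.
Proof. by rewrite /delta; case: pselect. Qed.

Lemma delta1 (P : Prop) (a b : C) (m : P -> hom a b) :
  P -> exists h, delta m = m h.
Proof. by rewrite /delta; case: pselect => // h _; exists h. Qed.

Definition id_entry (f : matobj) (x y : dom f) : hom (f x) (f y) :=
  delta (fun h : x = y => eqhom (congr1 f h)).

Lemma id_row_finite (f : matobj) : infinite_set (dom f) -> forall x : dom f,
  exists2 B : set (dom f), finite_set B & forall y, ~ B y -> id_entry x y = 0.
Proof.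
apply: seq_row_finite => x; exists [:: x] => y.
by rewrite inE => /eqP yx; apply: delta0 => /esym.
Qed.

Definition mat_id (f : matobj) : mathom f f :=
  MatHom (@id_row_finite f).

Definition comp_entry (f g h : matobj) (G : mathom g h) (F : mathom f g)
    (x : dom f) (y : dom h) : hom (f x) (h y) :=
  \sum_(z \in [set: dom g]) (G z y ∘ F x z).

Lemma comp0m (a b c : C) (f : hom a b) : (0 : hom b c) ∘ f = (0 : hom a c).
Proof.
by apply: (addIr ((0 : hom b c) ∘ f : hom a c)); rewrite -ab_compDl !add0r.
Qed.

Lemma compm0 (a b c : C) (f : hom b c) : f ∘ (0 : hom a b) = (0 : hom a c).
Proof.
by apply: (addIr (f ∘ (0 : hom a b) : hom a c)); rewrite -ab_compDr !add0r.
Qed.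

Lemma comp_suml (I : Type) (s : seq I) (a b c : C)
    (g : I -> hom b c) (f : hom a b) :
  (\sum_(i <- s) g i : hom b c) ∘ f = \sum_(i <- s) (g i ∘ f).
Proof.
elim: s => [|i s IH]; first by rewrite !big_nil comp0m.
by rewrite !big_cons -IH; exact: ab_compDl.
Qed.

Lemma comp_sumr (I : Type) (s : seq I) (a b c : C)
    (g : hom b c) (f : I -> hom a b) :
  g ∘ (\sum_(i <- s) f i : hom a b) = \sum_(i <- s) (g ∘ f i).
Proof.
elim: s => [|i s IH]; first by rewrite !big_nil compm0.
by rewrite !big_cons -IH; exact: ab_compDr.
Qed.

Lemma comp_entryE (f g h : matobj) (G : mathom g h) (F : mathom f g)
    (x : dom f) (y : dom h) (s : seq (dom g)) :
  uniq s -> (forall z, z \notin s -> F x z = 0) ->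
  comp_entry G F x y = \sum_(z <- s) (G z y ∘ F x z).
Proof.
move=> us sF; rewrite /comp_entry (fsbigE s) //.
  by apply: eq_bigl => z; rewrite in_setT.
by move=> z _ zs; rewrite sF // compm0.
Qed.

Lemma comp_support (f g h : matobj) (G : mathom g h) (F : mathom f g)
    (x : dom f) (s : seq (dom g)) : uniq s ->
  (forall z, z \notin s -> F x z = 0) ->
  exists t : seq (dom h), [/\ uniq t,
    forall z y, z \in s -> y \notin t -> G z y = 0 &
    forall y, y \notin t -> comp_entry G F x y = 0].
Proof.
move=> us sF.
have /choice[r rG] : forall z, exists t : seq (dom h),
    forall y, y \notin t -> G z y = 0.
  by move=> z; have [t _ tG] := row_seq G z; exists t.
have tG z y : z \in s -> y \notin undup (flatten (map r s)) -> G z y = 0.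
  move=> zs; rewrite mem_undup => yt; apply: rG; apply: contra yt => yr.
  by apply/flattenP; exists (r z) => //; exact: map_f.
exists (undup (flatten (map r s))); split=> //; first exact: undup_uniq.
move=> y yt; rewrite (comp_entryE _ _ us sF) big_seq big1 // => z zs.
by rewrite tG // comp0m.
Qed.

Lemma comp_row_finite (f g h : matobj) (G : mathom g h) (F : mathom f g) :
  infinite_set (dom h) -> forall x : dom f,
  exists2 B : set (dom h), finite_set B &
    forall y, ~ B y -> comp_entry G F x y = 0.
Proof.
apply: seq_row_finite => x; have [s us sF] := row_seq F x.
by have [t [_ _ tGF]] := comp_support G us sF; exists t.
Qed.

Definition mat_comp (f g h : matobj) (G : mathom g h) (F : mathom f g) :
  mathom f h := MatHom (@comp_row_finite f g h G F).

Lemma comp_row (f g h : matobj) (G : mathom g h) (F : mathom f g)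
    (x : dom f) (y : dom h) (z0 : dom g) :
  (forall z, z <> z0 -> F x z = 0) -> mat_comp G F x y = G z0 y ∘ F x z0.
Proof.
move=> F0 /=; rewrite (@comp_entryE _ _ _ _ _ _ _ [:: z0]) ?big_seq1 //.
by move=> z; rewrite inE => /eqP; exact: F0.
Qed.

Lemma comp_col (f g h : matobj) (G : mathom g h) (F : mathom f g)
    (x : dom f) (y : dom h) (z0 : dom g) :
  (forall z, z <> z0 -> G z y = 0) -> mat_comp G F x y = G z0 y ∘ F x z0.
Proof.
move=> G0 /=; have [s us sF] := row_seq F x.
rewrite (@comp_entryE _ _ _ _ _ _ _ (undup (z0 :: s))) ?undup_uniq //.
  rewrite (bigD1_seq z0) ?undup_uniq ?mem_undup ?mem_head //=.
  rewrite [X in _ + X]big1 ?addr0 // => z /eqP zz0.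
  by rewrite G0 // comp0m.
by move=> z; rewrite mem_undup inE negb_or => /andP[_]; exact: sF.
Qed.

Lemma mat_comp1m (f g : matobj) (F : mathom f g) : mat_comp (mat_id g) F = F.
Proof.
apply: mathom_ext => x y; rewrite (@comp_col _ _ _ _ _ _ _ y) /=.
  rewrite /id_entry; have [h ->] := @delta1 _ _ _ (fun h : y = y => eqhom (congr1 g h)) erefl.
  by rewrite (Prop_irrelevance h erefl) /=; exact: ab_comp1m.
by move=> z zy; exact: delta0.
Qed.

Lemma mat_compm1 (f g : matobj) (F : mathom f g) : mat_comp F (mat_id f) = F.
Proof.
apply: mathom_ext => x y; rewrite (@comp_row _ _ _ _ _ _ _ x) /=.
  rewrite /id_entry; have [h ->] := @delta1 _ _ _ (fun h : x = x => eqhom (congr1 f h)) erefl.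
  by rewrite (Prop_irrelevance h erefl) /=; exact: ab_compm1.
by move=> z zy; apply: delta0 => /esym.
Qed.

Lemma mat_compA (f g h k : matobj)
    (H : mathom h k) (G : mathom g h) (F : mathom f g) :
  mat_comp H (mat_comp G F) = mat_comp (mat_comp H G) F.
Proof.
apply: mathom_ext => x y /=; have [s us sF] := row_seq F x.
have [t [ut tG tGF]] := comp_support G us sF.
rewrite (@comp_entryE _ _ _ H (mat_comp G F) _ _ t) //.
rewrite (comp_entryE _ _ us sF) /=.
under eq_bigr do rewrite (comp_entryE _ _ us sF) comp_sumr.
rewrite exchange_big big_seq [RHS]big_seq; apply: eq_bigr => z zs.
rewrite (@comp_entryE _ _ _ _ _ _ _ t) //; last by move=> w; exact: tG.
by rewrite comp_suml; apply: eq_bigr => w _; exact: ab_compA.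
Qed.

Definition matcat : category := Category mat_comp1m mat_compm1 mat_compA.

End Matrices.

(** The set [γ (A × B)], with the coordinates of its elements. *)
Section Pairs.
Variables (S0 : choiceType) (γ : S0 * S0 -> S0).

Definition pairset (A B : set S0) : set S0 := γ @` (A `*` B).

Lemma pairsetP (A B : set S0) (p : pairset A B) :
  exists xy : A * B, γ (\val xy.1, \val xy.2) = \val p.
Proof.
case: p => p pP /=; have [[x y] [/= Ax By] <-] := set_mem pP.
by exists (exist _ x (mem_set Ax), exist _ y (mem_set By)).
Qed.

Definition coords (A B : set S0) (p : pairset A B) : A * B :=
  sval (cid (pairsetP p)).
Definition c1 (A B : set S0) (p : pairset A B) : A := (coords p).1.
Definition c2 (A B : set S0) (p : pairset A B) : B := (coords p).2.

Lemma ipair_subproof (A B : set S0) (x : A) (y : B) :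
  γ (\val x, \val y) \in pairset A B.
Proof.
by apply: mem_set; exists (\val x, \val y) => //; split;
  exact: set_mem (valP _).
Qed.

Definition ipair (A B : set S0) (x : A) (y : B) : pairset A B :=
  exist _ (γ (\val x, \val y)) (ipair_subproof x y).

Lemma pairK (A B : set S0) (p : pairset A B) : ipair (c1 p) (c2 p) = p.
Proof. by apply: val_inj; rewrite /= /c1 /c2 /coords; case: cid. Qed.

Lemma coords_inj (A B : set S0) (p q : pairset A B) :
  c1 p = c1 q -> c2 p = c2 q -> p = q.
Proof. by move=> e1 e2; rewrite -(pairK p) -(pairK q) e1 e2. Qed.

Hypothesis γ_bij : bijective γ.

Lemma coords_pair (A B : set S0) (x : A) (y : B) : coords (ipair x y) = (x, y).
Proof.
rewrite /coords; case: cid => -[x' y'] /= /(bij_inj γ_bij)[ex ey].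
by congr (_, _); exact: val_inj.
Qed.

Lemma c1_pair (A B : set S0) (x : A) (y : B) : c1 (ipair x y) = x.
Proof. by rewrite /c1 coords_pair. Qed.

Lemma c2_pair (A B : set S0) (x : A) (y : B) : c2 (ipair x y) = y.
Proof. by rewrite /c2 coords_pair. Qed.

End Pairs.

Section MatrixTensor.
Variables (C : abCategory) (M : monoidal C) (S0 : choiceType).
Variables (γ : S0 * S0 -> S0) (pt : S0).
Implicit Types f g h k : matobj C S0.

Definition mat_unit : matobj C S0 :=
  @MatObj C S0 [set pt] (fun=> unit_ob).

Definition mat_tens f g : matobj C S0 :=
  @MatObj C S0 (pairset γ (dom f) (dom g)) (fun p => f (c1 p) ⊗ g (c2 p)).

Definition tensm_entry f f' g g' (F : mathom f f') (G : mathom g g')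
    (p : dom (mat_tens f g)) (q : dom (mat_tens f' g')) :
    hom (mat_tens f g p) (mat_tens f' g' q) :=
  F (c1 p) (c1 q) ⊗m G (c2 p) (c2 q).

Hypothesis Mab : monoidal_ab M.

Lemma tens0m (a a' b b' : C) (g : hom b b') :
  (0 : hom a a') ⊗m g = (0 : hom (a ⊗ b) (a' ⊗ b')).
Proof.
apply: (addIr ((0 : hom a a') ⊗m g : hom (a ⊗ b) (a' ⊗ b'))).
by rewrite -(tensmDl Mab) !add0r.
Qed.

Lemma tensm0 (a a' b b' : C) (f : hom a a') :
  f ⊗m (0 : hom b b') = (0 : hom (a ⊗ b) (a' ⊗ b')).
Proof.
apply: (addIr (f ⊗m (0 : hom b b') : hom (a ⊗ b) (a' ⊗ b'))).
by rewrite -(tensmDr Mab) !add0r.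
Qed.

Lemma tens_suml (I : Type) (s : seq I) (a a' b b' : C)
    (f : I -> hom a a') (g : hom b b') :
  (\sum_(i <- s) f i : hom a a') ⊗m g = \sum_(i <- s) (f i ⊗m g).
Proof.
elim: s => [|i s IH]; first by rewrite !big_nil tens0m.
by rewrite !big_cons -IH (tensmDl Mab).
Qed.

Lemma tens_sumr (I : Type) (s : seq I) (a a' b b' : C)
    (f : hom a a') (g : I -> hom b b') :
  f ⊗m (\sum_(i <- s) g i : hom b b') = \sum_(i <- s) (f ⊗m g i).
Proof.
elim: s => [|i s IH]; first by rewrite !big_nil tensm0.
by rewrite !big_cons -IH (tensmDr Mab).
Qed.

Lemma tensm_support f f' g g' (F : mathom f f') (G : mathom g g')
    (p : dom (mat_tens f g)) (s : seq (dom f')) (t : seq (dom g')) :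
  (forall x, x \notin s -> F (c1 p) x = 0) ->
  (forall y, y \notin t -> G (c2 p) y = 0) ->
  forall q : dom (mat_tens f' g'),
    q \notin [seq ipair γ x y | x <- s, y <- t] -> tensm_entry F G p q = 0.
Proof.
move=> sF tG q qst; rewrite /tensm_entry.
have [xs|/sF->] := boolP (c1 q \in s); last exact: tens0m.
have [yt|/tG->] := boolP (c2 q \in t); last exact: tensm0.
case/negP: qst; rewrite -(pairK q).
by apply/allpairsP; exists (c1 q, c2 q).
Qed.

Lemma tensm_row_finite f f' g g' (F : mathom f f') (G : mathom g g') :
  infinite_set (dom (mat_tens f' g')) -> forall p : dom (mat_tens f g),
  exists2 B : set (dom (mat_tens f' g')), finite_set B &
    forall q, ~ B q -> tensm_entry F G p q = 0.
Proof.
apply: seq_row_finite => p.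
have [s _ sF] := row_seq F (c1 p); have [t _ tG] := row_seq G (c2 p).
by exists [seq ipair γ x y | x <- s, y <- t]; exact: tensm_support.
Qed.

Definition mat_tensm f f' g g' (F : mathom f f') (G : mathom g g') :
  mathom (mat_tens f g) (mat_tens f' g') :=
  MatHom (@tensm_row_finite f f' g g' F G).

Hypothesis st : strict M.

Lemma assoc_index f g h (p : dom (mat_tens (mat_tens f g) h))
    (q : dom (mat_tens f (mat_tens g h))) :
  c1 (c1 p) = c1 q /\ c2 (c1 p) = c1 (c2 q) /\ c2 p = c2 (c2 q) ->
  mat_tens (mat_tens f g) h p = mat_tens f (mat_tens g h) q.
Proof. by move=> /= [-> [-> ->]]; exact: tensA. Qed.

Definition assoc_entry f g h (p : dom (mat_tens (mat_tens f g) h))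
    (q : dom (mat_tens f (mat_tens g h))) :
    hom (mat_tens (mat_tens f g) h p) (mat_tens f (mat_tens g h) q) :=
  delta (fun e => eqhom (@assoc_index f g h p q e)).

Definition associ_entry f g h (q : dom (mat_tens f (mat_tens g h)))
    (p : dom (mat_tens (mat_tens f g) h)) :
    hom (mat_tens f (mat_tens g h) q) (mat_tens (mat_tens f g) h p) :=
  delta (fun e => eqhom (esym (@assoc_index f g h p q e))).

Lemma runit_index f (p : dom (mat_tens f mat_unit)) (x : dom f) :
  c1 p = x -> mat_tens f mat_unit p = f x.
Proof. by move=> /= ->; exact: tens1. Qed.

Definition runit_entry f (p : dom (mat_tens f mat_unit)) (x : dom f) :
    hom (mat_tens f mat_unit p) (f x) :=
  delta (fun e => eqhom (@runit_index f p x e)).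

Lemma lunit_index f (p : dom (mat_tens mat_unit f)) (x : dom f) :
  c2 p = x -> mat_tens mat_unit f p = f x.
Proof. by move=> /= ->; exact: tens1o. Qed.

Definition lunit_entry f (p : dom (mat_tens mat_unit f)) (x : dom f) :
    hom (mat_tens mat_unit f p) (f x) :=
  delta (fun e => eqhom (@lunit_index f p x e)).

(** A matrix with at most one nonzero entry in each row is row-finite. *)
Lemma row1_finite f g (F : forall (x : dom f) (y : dom g), hom (f x) (g y))
    (σ : dom f -> dom g) :
  (forall x y, y <> σ x -> F x y = 0) ->
  infinite_set (dom g) -> forall x : dom f,
  exists2 B : set (dom g), finite_set B & forall y, ~ B y -> F x y = 0.
Proof.
move=> F0; apply: seq_row_finite => x; exists [:: σ x] => y.
by rewrite inE => /eqP; exact: F0.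
Qed.

Definition assoc_fwd f g h (p : dom (mat_tens (mat_tens f g) h)) :
    dom (mat_tens f (mat_tens g h)) :=
  ipair γ (c1 (c1 p)) (ipair γ (c2 (c1 p)) (c2 p)).

Definition assoc_bwd f g h (q : dom (mat_tens f (mat_tens g h))) :
    dom (mat_tens (mat_tens f g) h) :=
  ipair γ (ipair γ (c1 q) (c1 (c2 q))) (c2 (c2 q)).

Lemma assoc_entry0 f g h p q :
  q <> assoc_fwd p -> @assoc_entry f g h p q = 0.
Proof.
move=> qp; apply: delta0 => -[e1 [e2 e3]]; apply: qp.
by rewrite /assoc_fwd e1 e2 e3 !pairK.
Qed.

Lemma associ_entry0 f g h q p :
  p <> assoc_bwd q -> @associ_entry f g h q p = 0.
Proof.
move=> qp; apply: delta0 => -[e1 [e2 e3]]; apply: qp.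
by rewrite /assoc_bwd -e1 -e2 -e3 !pairK.
Qed.

Lemma runit_entry0 f (p : dom (mat_tens f mat_unit)) (x : dom f) :
  x <> c1 p -> @runit_entry f p x = 0.
Proof. by move=> xp; apply: delta0 => /esym. Qed.

Lemma lunit_entry0 f (p : dom (mat_tens mat_unit f)) (x : dom f) :
  x <> c2 p -> @lunit_entry f p x = 0.
Proof. by move=> xp; apply: delta0 => /esym. Qed.

Definition mat_assoc f g h :
  mathom (mat_tens (mat_tens f g) h) (mat_tens f (mat_tens g h)) :=
  MatHom (row1_finite (@assoc_entry0 f g h)).

Definition mat_associ f g h :
  mathom (mat_tens f (mat_tens g h)) (mat_tens (mat_tens f g) h) :=
  MatHom (row1_finite (@associ_entry0 f g h)).

Definition mat_runit f : mathom (mat_tens f mat_unit) f :=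
  MatHom (row1_finite (@runit_entry0 f)).

Definition mat_lunit f : mathom (mat_tens mat_unit f) f :=
  MatHom (row1_finite (@lunit_entry0 f)).

(** [F] is the permutation-like matrix of [σ], all of whose nonzero entries are
    identities of [C]. *)
Definition is_perm f g (F : mathom f g) (σ : dom f -> dom g) :=
  (forall x y, y = σ x -> exists e : f x = g y, F x y = eqhom e) /\
  (forall x y, y <> σ x -> F x y = 0).

Lemma eqhom_irr (a b : C) (e e' : a = b) : eqhom e = eqhom e'.
Proof. by rewrite (Prop_irrelevance e e'). Qed.

Lemma eqhom1 (a : C) (e : a = a) : eqhom e = idc a.
Proof. by rewrite (eqhom_irr e erefl). Qed.

Lemma eqhom_comp (a b d : C) (e : a = b) (e' : b = d) :
  eqhom e' ∘ eqhom e = eqhom (etrans e e').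
Proof. by case: d / e'; case: b / e; rewrite /= comp1m. Qed.

Lemma eqhom_tens (a b a' b' : C) (e : a = b) (e' : a' = b') :
  eqhom e ⊗m eqhom e' = eqhom (congr2 tens e e').
Proof. by case: b / e; case: b' / e'; rewrite tensm1 eqhom1. Qed.

Lemma perm_eq_mat f g (F G : mathom f g) σ τ :
  is_perm F σ -> is_perm G τ -> σ =1 τ -> F = G.
Proof.
move=> [F1 F0] [G1 G0] στ; apply: mathom_ext => x y.
have [yx|yx] := pselect (y = σ x); last by rewrite F0 // G0 // -στ.
have [e ->] := F1 _ _ yx; rewrite στ in yx.
by have [e' ->] := G1 _ _ yx; exact: eqhom_irr.
Qed.

Lemma perm_id f : is_perm (mat_id f) id.
Proof.
split=> x y yx; last by apply: delta0 => /esym.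
have [e E] := @delta1 C (x = y) _ _ (fun e => eqhom (congr1 f e)) (esym yx).
by exists (congr1 f e).
Qed.

Lemma perm_comp f g h (G : mathom g h) (F : mathom f g) σ τ :
  is_perm F σ -> is_perm G τ -> is_perm (mat_comp G F) (τ \o σ).
Proof.
move=> [F1 F0] [G1 G0]; split=> x y yx; rewrite (@comp_row _ _ _ _ _ _ _ _ _ (σ x));
  try by move=> z; exact: F0.
  have [e ->] := F1 x _ erefl; have [e' ->] := G1 _ _ yx.
  by rewrite eqhom_comp; exists (etrans e e').
by rewrite G0 // comp0m.
Qed.

Lemma perm_delta f g (F : mathom f g) (σ : dom f -> dom g)
    (P : dom f -> dom g -> Prop) (E : forall x y, P x y -> f x = g y) :
  (forall x y, F x y = delta (fun e => eqhom (E x y e))) ->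
  (forall x, P x (σ x)) -> (forall x y, y <> σ x -> F x y = 0) ->
  is_perm F σ.
Proof.
move=> FE Pσ F0; split=> // x y yx; rewrite FE.
have Pxy : P x y by rewrite yx.
by have [e ->] := delta1 (fun e => eqhom (E x y e)) Pxy; exists (E x y e).
Qed.

Hypothesis γ_bij : bijective γ.

Lemma perm_tens f f' g g' (F : mathom f f') (G : mathom g g') σ τ :
  is_perm F σ -> is_perm G τ ->
  is_perm (mat_tensm F G) (fun p => ipair γ (σ (c1 p)) (τ (c2 p))).
Proof.
move=> [F1 F0] [G1 G0]; split=> p q.
  move=> qp; rewrite /= /tensm_entry.
  have [|e ->] := F1 (c1 p) (c1 q); first by rewrite qp c1_pair.
  have [|e' ->] := G1 (c2 p) (c2 q); first by rewrite qp c2_pair.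
  by rewrite eqhom_tens; exists (congr2 tens e e').
move=> qp /=; rewrite /tensm_entry.
have [q1|q1] := pselect (c1 q = σ (c1 p)); last by rewrite F0 // tens0m.
rewrite G0 ?tensm0 // => q2; apply: qp.
by rewrite -q1 -q2 pairK.
Qed.

Lemma perm_assoc f g h : is_perm (mat_assoc f g h) (@assoc_fwd f g h).
Proof.
apply: (perm_delta (E := @assoc_index f g h)) => [//|p|]; last exact: assoc_entry0.
by rewrite /assoc_fwd !(c1_pair γ_bij, c2_pair γ_bij).
Qed.

Lemma perm_associ f g h : is_perm (mat_associ f g h) (@assoc_bwd f g h).
Proof.
apply: (perm_delta (E := fun q p e => esym (@assoc_index f g h p q e))) => [//|q|];
  last exact: associ_entry0.
by rewrite /assoc_bwd !(c1_pair γ_bij, c2_pair γ_bij).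
Qed.

Lemma perm_runit f : is_perm (mat_runit f) (fun p => c1 p).
Proof. by apply: (perm_delta (E := @runit_index f)) => //; exact: runit_entry0. Qed.

Lemma perm_lunit f : is_perm (mat_lunit f) (fun p => c2 p).
Proof. by apply: (perm_delta (E := @lunit_index f)) => //; exact: lunit_entry0. Qed.

Lemma assoc_fwdK f g h : cancel (@assoc_fwd f g h) (@assoc_bwd f g h).
Proof.
move=> p; rewrite /assoc_bwd /assoc_fwd.
by rewrite !(c1_pair γ_bij, c2_pair γ_bij) !pairK.
Qed.

Lemma assoc_bwdK f g h : cancel (@assoc_bwd f g h) (@assoc_fwd f g h).
Proof.
move=> p; rewrite /assoc_bwd /assoc_fwd.
by rewrite !(c1_pair γ_bij, c2_pair γ_bij) !pairK.
Qed.

Lemma mat_assocK f g h :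
  @inverses (matcat C S0) _ _ (mat_assoc f g h) (mat_associ f g h).
Proof.
split; [apply: (perm_eq_mat (perm_comp (perm_assoc f g h) (perm_associ f g h)))
       |apply: (perm_eq_mat (perm_comp (perm_associ f g h) (perm_assoc f g h)))];
  (try exact: perm_id) => p /=; [exact: assoc_fwdK | exact: assoc_bwdK].
Qed.

Definition star : dom mat_unit := exist _ pt (mem_set (erefl pt)).

Lemma starE (x : dom mat_unit) : x = star.
Proof. by apply: val_inj; exact: (set_mem (valP x)). Qed.

(** A permutation-like matrix of a bijection is invertible. *)
Lemma perm_iso f g (F : mathom f g) σ τ :
  is_perm F σ -> cancel σ τ -> cancel τ σ -> @is_iso (matcat C S0) f g F.
Proof.
move=> FP σK τK.
have E y x : x = τ y -> g y = f x.
  by move=> ->; have [e _] := FP.1 (τ y) _ (esym (τK y)).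
have G0 y x : x <> τ y -> delta (fun e => eqhom (E y x e)) = 0.
  by move=> xy; apply: delta0.
pose G : mathom g f := MatHom (row1_finite G0).
have GP : is_perm G τ by apply: (perm_delta (E := E)).
exists G; split; [apply: (perm_eq_mat (perm_comp FP GP))
  | apply: (perm_eq_mat (perm_comp GP FP))]; (try exact: perm_id); move=> x /=.
- exact: σK.
- exact: τK.
Qed.

Lemma mat_runit_iso f : @is_iso (matcat C S0) _ _ (mat_runit f).
Proof.
pose τ (x : dom f) : dom (mat_tens f mat_unit) := ipair γ x star.
apply: (@perm_iso (mat_tens f mat_unit) f (mat_runit f) _ τ (perm_runit f)); rewrite /τ.
  by move=> p; rewrite -[RHS]pairK (starE (c2 p)).
by move=> x; rewrite c1_pair.
Qed.

Lemma mat_lunit_iso f : @is_iso (matcat C S0) _ _ (mat_lunit f).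
Proof.
pose τ (x : dom f) : dom (mat_tens mat_unit f) := ipair γ star x.
apply: (@perm_iso (mat_tens mat_unit f) f (mat_lunit f) _ τ (perm_lunit f)); rewrite /τ.
  by move=> p; rewrite -[RHS]pairK (starE (c1 p)).
by move=> x; rewrite c2_pair.
Qed.

Lemma mat_tensm1 f g : mat_tensm (mat_id f) (mat_id g) = mat_id (mat_tens f g).
Proof.
apply: (perm_eq_mat (perm_tens (perm_id f) (perm_id g)) (perm_id _)) => p /=.
exact: pairK.
Qed.

Lemma mat_tensm_comp f f' f'' g g' g'' (F' : mathom f' f'') (F : mathom f f')
    (G' : mathom g' g'') (G : mathom g g') :
  mat_tensm (mat_comp F' F) (mat_comp G' G) =
  mat_comp (mat_tensm F' G') (mat_tensm F G).
Proof.
apply: mathom_ext => p q /=; rewrite {1}/tensm_entry /=.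
have [s us sF] := row_seq F (c1 p); have [t ut tG] := row_seq G (c2 p).
rewrite (comp_entryE _ _ us sF) (comp_entryE _ _ ut tG).
pose r : seq (dom (mat_tens f' g')) := [seq ipair γ x y | x <- s, y <- t].
rewrite (@comp_entryE _ _ _ _ _ _ _ _ _ r).
- rewrite /r big_allpairs_dep tens_suml; apply: eq_bigr => x _.
  rewrite tens_sumr; apply: eq_bigr => y _ /=.
  rewrite tensm_comp /tensm_entry.
  by rewrite (c1_pair γ_bij) (c2_pair γ_bij).
- apply: allpairs_uniq => // -[x y] [x' y'] _ _ /= E.
  have := congr1 (@c1 _ _ _ _) E; have := congr1 (@c2 _ _ _ _) E.
  by rewrite !(c1_pair γ_bij, c2_pair γ_bij) => -> ->.
- exact: tensm_support.
Qed.

Lemma assoc_nat_entry f f' g g' h h' (F : mathom f f') (G : mathom g g')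
    (H : mathom h h') x1 x2 y1 y2 z1 z2 x1' x2' y1' y2' z1' z2'
    (e' : (f' x1' ⊗ g' y1') ⊗ h' z1' = f' x2' ⊗ (g' y2' ⊗ h' z2'))
    (e : (f x1 ⊗ g y1) ⊗ h z1 = f x2 ⊗ (g y2 ⊗ h z2)) :
  x1 = x2 -> y1 = y2 -> z1 = z2 -> x1' = x2' -> y1' = y2' -> z1' = z2' ->
  eqhom e' ∘ ((F x1 x1' ⊗m G y1 y1') ⊗m H z1 z1') =
  (F x2 x2' ⊗m (G y2 y2' ⊗m H z2 z2')) ∘ eqhom e.
Proof.
move=> ex ey ez ex' ey' ez'; subst.
rewrite (eqhom_irr e (tensA st _ _ _)) (eqhom_irr e' (tensA st _ _ _)).
by rewrite -!(assocE st) assoc_nat.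
Qed.

Lemma mat_assoc_nat f f' g g' h h' (F : mathom f f') (G : mathom g g')
    (H : mathom h h') :
  mat_comp (mat_assoc f' g' h') (mat_tensm (mat_tensm F G) H) =
  mat_comp (mat_tensm F (mat_tensm G H)) (mat_assoc f g h).
Proof.
apply: mathom_ext => p q; have [A1 A0] := perm_assoc f g h.
have [A1' A0'] := perm_assoc f' g' h'.
rewrite (@comp_row _ _ _ _ _ _ _ _ _ (assoc_fwd p)); last by move=> z; exact: A0.
rewrite (@comp_col _ _ _ _ _ _ _ _ _ (assoc_bwd q)); last first.
  by move=> z zq; apply: (A0' z q) => qz; apply: zq; rewrite qz; exact/esym/assoc_fwdK.
have [e ->] := A1 p _ erefl.
have [e' ->] := A1' (assoc_bwd q) q (esym (assoc_bwdK q)).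
by apply: assoc_nat_entry; rewrite /assoc_fwd /assoc_bwd
  ?(c1_pair γ_bij, c2_pair γ_bij).
Qed.

Lemma mat_runit_nat f f' (F : mathom f f') :
  mat_comp (mat_runit f') (mat_tensm F (mat_id mat_unit)) =
  mat_comp F (mat_runit f).
Proof.
apply: mathom_ext => p x; have [R1 R0] := perm_runit f.
have [R1' R0'] := perm_runit f'; have [I1 _] := perm_id mat_unit.
rewrite (@comp_row _ _ _ _ _ _ _ _ _ (c1 p)); last by move=> z; exact: R0.
rewrite (@comp_col _ _ _ _ _ _ _ _ _ (ipair γ x star : dom (mat_tens f' mat_unit))); last first.
  move=> z zq; apply: R0' => xz; apply: zq.
  by rewrite xz -(starE (c2 z)) pairK.
have [e ->] := R1 p _ erefl.
have [e' ->] := R1' (ipair γ x star : dom (mat_tens f' mat_unit)) x (esym (c1_pair γ_bij _ _)).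
rewrite /= /tensm_entry /=.
have [|d] := I1 (c2 p) (c2 (ipair γ x star)); first exact: etrans (starE _) (esym (starE _)).
rewrite /= => ->; move: e' d => /=.
rewrite (c1_pair γ_bij) => e' d.
rewrite (eqhom_irr e (tens1 st _)) (eqhom_irr e' (tens1 st _)) (eqhom1 d).
by rewrite -!(runitE st) runit_nat.
Qed.

Lemma mat_lunit_nat f f' (F : mathom f f') :
  mat_comp (mat_lunit f') (mat_tensm (mat_id mat_unit) F) =
  mat_comp F (mat_lunit f).
Proof.
apply: mathom_ext => p x; have [R1 R0] := perm_lunit f.
have [R1' R0'] := perm_lunit f'; have [I1 _] := perm_id mat_unit.
rewrite (@comp_row _ _ _ _ _ _ _ _ _ (c2 p)); last by move=> z; exact: R0.
rewrite (@comp_col _ _ _ _ _ _ _ _ _ (ipair γ star x : dom (mat_tens mat_unit f'))); last first.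
  move=> z zq; apply: R0' => xz; apply: zq.
  by rewrite xz -(starE (c1 z)) pairK.
have [e ->] := R1 p _ erefl.
have [e' ->] := R1' (ipair γ star x : dom (mat_tens mat_unit f')) x (esym (c2_pair γ_bij _ _)).
rewrite /= /tensm_entry /=.
have [|d] := I1 (c1 p) (c1 (ipair γ star x)); first exact: etrans (starE _) (esym (starE _)).
rewrite /= => ->; move: e' d => /=.
rewrite (c2_pair γ_bij) => e' d.
rewrite (eqhom_irr e (tens1o st _)) (eqhom_irr e' (tens1o st _)) (eqhom1 d).
by rewrite -!(lunitE st) lunit_nat.
Qed.

Lemma mat_pentagon f g h k :
  mat_comp (mat_assoc f g (mat_tens h k)) (mat_assoc (mat_tens f g) h k) =
  mat_comp (mat_comp (mat_tensm (mat_id f) (mat_assoc g h k))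
                     (mat_assoc f (mat_tens g h) k))
           (mat_tensm (mat_assoc f g h) (mat_id k)).
Proof.
apply: (perm_eq_mat (perm_comp (perm_assoc _ _ _) (perm_assoc _ _ _))
  (perm_comp (perm_tens (perm_assoc _ _ _) (perm_id _))
    (perm_comp (perm_assoc _ _ _) (perm_tens (perm_id _) (perm_assoc _ _ _))))).
by move=> p; rewrite /= /assoc_fwd !(c1_pair γ_bij, c2_pair γ_bij).
Qed.

Lemma mat_triangle f g :
  mat_comp (mat_tensm (mat_id f) (mat_lunit g)) (mat_assoc f mat_unit g) =
  mat_tensm (mat_runit f) (mat_id g).
Proof.
apply: (perm_eq_mat (perm_comp (perm_assoc _ _ _)
    (perm_tens (perm_id _) (perm_lunit _)))
  (perm_tens (perm_runit _) (perm_id _))).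
by move=> p; rewrite /= /assoc_fwd !(c1_pair γ_bij, c2_pair γ_bij).
Qed.

Definition matmonoidal : monoidal (matcat C S0) :=
  @Monoidal (matcat C S0) mat_unit mat_tens mat_tensm
    mat_assoc mat_associ mat_runit mat_lunit
    mat_tensm1 mat_tensm_comp mat_assoc_nat mat_runit_nat mat_lunit_nat
    mat_assocK mat_runit_iso mat_lunit_iso mat_pentagon mat_triangle.

(** The candidate braiding: its entry at [(γ(x,y), γ(y',x'))] is
    [δ_{x,x'} δ_{y,y'} c_{f(x),g(y)}]; the δ's identify [g(y) ⊗ f(x)] with
    [g(y') ⊗ f(x')]. *)
Variable c : forall a b : C, hom (a ⊗ b) (b ⊗ a).

Definition braid_entry f g (p : dom (mat_tens f g)) (q : dom (mat_tens g f)) :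
    hom (mat_tens f g p) (mat_tens g f q) :=
  delta (fun e : c1 p = c2 q /\ c2 p = c1 q =>
    eqhom (congr2 tens (congr1 g e.2) (congr1 f e.1)) ∘ c (f (c1 p)) (g (c2 p))).

Lemma braid_entry0 f g (p : dom (mat_tens f g)) (q : dom (mat_tens g f)) :
  q <> ipair γ (c2 p) (c1 p) -> @braid_entry f g p q = 0.
Proof.
by move=> qp; apply: delta0 => -[e1 e2]; apply: qp; rewrite e1 e2 pairK.
Qed.

Definition mat_braid f g : mathom (mat_tens f g) (mat_tens g f) :=
  MatHom (row1_finite (@braid_entry0 f g)).

End MatrixTensor.

(* Main.v *)
Require Import Defs.
From mathcomp Require Import all_boot ssralg boolp classical_sets cardinality.

Set Implicit Arguments.
Unset Strict Implicit.
Unset Printing Implicit Defensive.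

Local Open Scope classical_set_scope.
Local Open Scope cat_scope.

(** The matrix [C_{f,g}] has exactly one possibly nonzero entry in each row and
    each column, namely [c_{f(x),g(y)}] in row [(x,y)] and column [(y,x)]; the
    associators and identities of the matrix category have the same shape.  For
    such matrices the sums that define composition have a single term, so each
    axiom of a braiding reduces, entry by entry, to the same axiom for [c].
    - Rows: [concentrated F x y m] says that row [x] of [F] is zero except at
      [y], where it is [m].  Concentrated rows compose and tensor as their
      values do ([concentrated_comp], [concentrated_tens]), so the hexagons for
      [C] in row [(x,y,z)] are the hexagons for [c] at [f(x)], [g(y)], [h(z)].
    - Inverses: a matrix supported on the graph of a bijection, with invertible
      entries there, is invertible ([monomial_iso]).
    - Naturality: [F] and [G] are arbitrary, but composing with [C] on either
      side still leaves one summand, and the two sides are those of the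
      naturality square of [c] for [F(x,x')] and [G(y,y')].
    The one technical point is that the coordinates of a pair are recovered from
    the pair by choice, so [(f ⊗ g)(γ(x,y))] equals [f(x) ⊗ g(y)] only
    propositionally.  Entries are therefore compared by [eqmor], equality of
    morphisms up to equality of their sources and of their targets. *)

(** * Morphisms with equal endpoints *)

Section EqualMorphisms.
Variable C : abCategory.

(** Equality of two morphisms whose endpoints are equal but possibly not
    convertible; the square with the equality isomorphisms replaces a
    transport, so that no rewriting inside types is needed. *)
Definition eqmor (a b : C) (m : hom a b) (a' b' : C) (m' : hom a' b') :=
  exists (ea : a = a') (eb : b = b'), eqhom eb ∘ m = m' ∘ eqhom ea.

Lemma eqmor_refl (a b : C) (m : hom a b) : eqmor m m.
Proof. by exists erefl, erefl; rewrite /= comp1m compm1. Qed.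

Lemma eqmorP (a b : C) (m m' : hom a b) : eqmor m m' -> m = m'.
Proof. by case=> ea [eb]; rewrite !eqhom1 comp1m compm1. Qed.

Lemma eqmor_sym (a b : C) (m : hom a b) (a' b' : C) (m' : hom a' b') :
  eqmor m m' -> eqmor m' m.
Proof.
case=> ea [eb]; case: a' / ea m' => m'; case: b' / eb m' => m' /=.
by rewrite comp1m compm1 => ->; exact: eqmor_refl.
Qed.

Lemma eqmor_trans (a b : C) (m : hom a b) (a' b' : C) (m' : hom a' b')
    (a'' b'' : C) (m'' : hom a'' b'') :
  eqmor m m' -> eqmor m' m'' -> eqmor m m''.
Proof.
case=> ea [eb]; case: a' / ea m' => m'; case: b' / eb m' => m' /=.
by rewrite comp1m compm1 => ->.
Qed.

Lemma eqmor_comp (a b d : C) (n : hom b d) (m : hom a b)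
    (a' b' d' : C) (n' : hom b' d') (m' : hom a' b') :
  eqmor n n' -> eqmor m m' -> eqmor (n ∘ m) (n' ∘ m').
Proof.
move=> [eb [ed En]] [ea [eb' Em]]; exists ea, ed.
by rewrite Defs.compA En -Defs.compA (eqhom_irr eb eb') Em Defs.compA.
Qed.

Lemma eqmor_tens {M : monoidal C} (a b d e : C) (m : hom a b) (n : hom d e)
    (a' b' d' e' : C) (m' : hom a' b') (n' : hom d' e') :
  eqmor m m' -> eqmor n n' -> eqmor (m ⊗m n) (m' ⊗m n').
Proof.
move=> [ea [eb Em]] [ed [ee En]].
exists (congr2 tens ea ed), (congr2 tens eb ee).
by rewrite -!eqhom_tens -!tensm_comp Em En.
Qed.

Lemma eqmor_eqhom (a b a' b' : C) (e : a = b) (e' : a' = b') :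
  a = a' -> eqmor (eqhom e) (eqhom e').
Proof.
move=> ea; case: b / e; case: b' / e'; case: a' / ea; exact: eqmor_refl.
Qed.

Lemma eqmor_eqhoml (a b d : C) (m : hom a b) (e : b = d) :
  eqmor (eqhom e ∘ m) m.
Proof. by case: d / e; rewrite /= comp1m; exact: eqmor_refl. Qed.

Lemma eqmor_braid (M : monoidal C) (c : forall a b : C, hom (a ⊗ b) (b ⊗ a)) (a b a' b' : C) :
  a = a' -> b = b' -> eqmor (c a b) (c a' b').
Proof. by move=> <- <-; exact: eqmor_refl. Qed.

Lemma associE (M : monoidal C) (st : strict M) (a b d : C) :
  associ a b d = eqhom (esym (tensA st a b d)).
Proof.
have [_ aK] := assocK a b d.
rewrite -[LHS]comp1m -(eqhom1 (etrans (tensA st a b d) (esym (tensA st a b d)))).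
by rewrite -eqhom_comp -(assocE st) -Defs.compA aK compm1.
Qed.

(** The chosen inverse is meaningful only for invertible morphisms; being total
    lets it be used entrywise on a matrix. *)
Definition inv (a b : C) (m : hom a b) : hom b a :=
  match pselect (is_iso m) with left h => sval (cid h) | right _ => 0%R end.

Lemma invP (a b : C) (m : hom a b) : is_iso m -> inverses m (inv m).
Proof. by rewrite /inv; case: pselect => // h _; case: cid. Qed.

Lemma eqmor_iso (a b a' b' : C) (m : hom a b) (m' : hom a' b') :
  eqmor m m' -> is_iso m' -> is_iso m.
Proof.
case=> ea [eb]; case: a' / ea m' => m'; case: b' / eb m' => m' /=.
by rewrite comp1m compm1 => ->.
Qed.

End EqualMorphisms.

(** * Rows with one nonzero entry *)

Section ConcentratedRows.
Variables (C : abCategory) (S0 : choiceType).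
Implicit Types f g h : matobj C S0.

Definition concentrated f g (F : mathom f g) (x : dom f) (y : dom g)
    (a b : C) (m : hom a b) :=
  eqmor (F x y) m /\ forall z, z <> y -> F x z = 0%R.

Lemma concentrated_eq f g (F G : mathom f g) :
  (forall x, exists y (a b : C) (m : hom a b),
     concentrated F x y m /\ concentrated G x y m) -> F = G.
Proof.
move=> FG; apply: mathom_ext => x z.
have [y [a [b [m [[Fm F0] [Gm G0]]]]]] := FG x.
have [->|zy] := pselect (z = y); last by rewrite F0 // G0.
exact: eqmorP (eqmor_trans Fm (eqmor_sym Gm)).
Qed.

Lemma concentrated_id f (x : dom f) :
  concentrated (mat_id f) x x (idc (f x)).
Proof.
have [I1 I0] := perm_id f; split=> [|z]; last exact: I0.
by have [e ->] := I1 x x erefl; rewrite eqhom1; exact: eqmor_refl.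
Qed.

Lemma concentrated_comp f g h (G : mathom g h) (F : mathom f g)
    (x : dom f) (y : dom g) (z : dom h) (a b d : C)
    (n : hom b d) (m : hom a b) :
  concentrated F x y m -> concentrated G y z n ->
  concentrated (mat_comp G F) x z (n ∘ m).
Proof.
move=> [Fm F0] [Gn G0]; split=> [|w wz]; rewrite (comp_row _ _ F0).
  exact: eqmor_comp.
by rewrite G0 // comp0m.
Qed.

(** The inverse has the inverted entries at the transposed positions; each row
    of either composite is then concentrated on the diagonal with value an
    identity. *)
Lemma monomial_iso f g (F : mathom f g) (σ : dom f -> dom g) τ :
  cancel σ τ -> cancel τ σ ->
  (forall x, is_iso (F x (σ x))) -> (forall x y, y <> σ x -> F x y = 0%R) ->
  @is_iso (matcat C S0) f g F.
Proof.
move=> σK τK Fiso F0.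
pose G_entry (y : dom g) (x : dom f) : hom (g y) (f x) :=
  delta (fun _ : x = τ y => inv (F x y)).
have G0 y x : x <> τ y -> G_entry y x = 0%R by exact: delta0.
pose G : mathom g f := MatHom (row1_finite G0).
have GE x : concentrated G (σ x) x (inv (F x (σ x))).
  split=> [|z]; last by rewrite -{1}[x]σK; exact: G0.
  have e : x = τ (σ x) by rewrite σK.
  rewrite /= /G_entry; have [_ ->] := delta1 (fun=> inv (F x (σ x))) e.
  exact: eqmor_refl.
have FE x : concentrated F x (σ x) (F x (σ x)).
  by split; [exact: eqmor_refl | exact: F0].
exists G; split; apply: concentrated_eq; [move=> x | move=> y].
  exists x, (f x), (f x), (idc (f x)); split; last exact: concentrated_id.
  by have [<- _] := invP (Fiso x); exact: concentrated_comp (FE x) (GE x).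
rewrite -(τK y); set x := τ y.
exists (σ x), (g (σ x)), (g (σ x)), (idc (g (σ x))).
split; last exact: concentrated_id.
by have [_ <-] := invP (Fiso x); exact: concentrated_comp (GE x) (FE x).
Qed.

End ConcentratedRows.

(** * Rows of tensor products, associators and the braiding *)

Section TensorRows.
Variables (C : abCategory) (M : monoidal C) (Mab : monoidal_ab M).
Variables (st : strict M) (S0 : choiceType).
Variables (γ : S0 * S0 -> S0) (γ_bij : bijective γ).
Implicit Types f g h : matobj C S0.

Lemma pair_ind (A B : set S0) (P : pairset γ A B -> Prop) :
  (forall x y, P (ipair γ x y)) -> forall p, P p.
Proof. by move=> Pxy p; rewrite -(pairK p). Qed.

Lemma mat_tens_pair f g (x : dom f) (y : dom g) :
  mat_tens M γ f g (ipair γ x y) = f x ⊗ g y.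
Proof. by rewrite /= c1_pair // c2_pair. Qed.

Lemma tensm_pair f f' g g' (F : mathom f f') (G : mathom g g')
    (x : dom f) (x' : dom f') (y : dom g) (y' : dom g') :
  eqmor (mat_tensm γ Mab F G (ipair γ x y) (ipair γ x' y'))
        (F x x' ⊗m G y y').
Proof.
rewrite /= /tensm_entry; apply: eqmor_tens.
  by rewrite !(c1_pair γ_bij); exact: eqmor_refl.
by rewrite !(c2_pair γ_bij); exact: eqmor_refl.
Qed.

Lemma concentrated_tens f f' g g' (F : mathom f f') (G : mathom g g')
    (x : dom f) (x' : dom f') (y : dom g) (y' : dom g')
    (a b d e : C) (m : hom a b) (n : hom d e) :
  concentrated F x x' m -> concentrated G y y' n ->
  concentrated (mat_tensm γ Mab F G) (ipair γ x y) (ipair γ x' y') (m ⊗m n).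
Proof.
move=> [Fm F0] [Gn G0]; split.
  exact: eqmor_trans (tensm_pair _ _ _ _ _ _) (eqmor_tens Fm Gn).
apply: pair_ind => u v uv; apply: eqmorP.
apply: eqmor_trans (tensm_pair F G x u y v) _.
have E : F x u ⊗m G y v = 0%R.
  have [ux|/F0->] := pselect (u = x'); last exact: tens0m.
  have [vy|/G0->] := pselect (v = y'); last exact: tensm0.
  by case: uv; rewrite ux vy.
rewrite E.
(* both sides are zero, but between objects that are only provably equal *)
have zero_eqmor (a1 b1 a2 b2 : C) : a1 = a2 -> b1 = b2 ->
    eqmor (0%R : hom a1 b1) (0%R : hom a2 b2).
  by move=> <- <-; exact: eqmor_refl.
by apply: zero_eqmor; rewrite mat_tens_pair.
Qed.

Lemma concentrated_assoc f g h (x : dom f) (y : dom g) (z : dom h) :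
  concentrated (mat_assoc γ st f g h)
    (ipair γ (ipair γ x y) z) (ipair γ x (ipair γ y z))
    (assoc (f x) (g y) (h z)).
Proof.
have [A1 A0] := perm_assoc st γ_bij f g h.
have E : ipair γ x (ipair γ y z) =
    assoc_fwd (ipair γ (ipair γ x y) z : dom (mat_tens M γ (mat_tens M γ f g) h)).
  by rewrite /assoc_fwd !(c1_pair γ_bij, c2_pair γ_bij).
split=> [|w]; last by rewrite E; exact: A0.
have [e ->] := A1 _ _ E; rewrite (assocE st); apply: eqmor_eqhom.
by rewrite mat_tens_pair mat_tens_pair.
Qed.

Lemma concentrated_associ f g h (x : dom f) (y : dom g) (z : dom h) :
  concentrated (mat_associ γ st f g h)
    (ipair γ x (ipair γ y z)) (ipair γ (ipair γ x y) z)
    (associ (f x) (g y) (h z)).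
Proof.
have [A1 A0] := perm_associ st γ_bij f g h.
have E : ipair γ (ipair γ x y) z =
    assoc_bwd (ipair γ x (ipair γ y z) : dom (mat_tens M γ f (mat_tens M γ g h))).
  by rewrite /assoc_bwd !(c1_pair γ_bij, c2_pair γ_bij).
split=> [|w]; last by rewrite E; exact: A0.
have [e ->] := A1 _ _ E; rewrite (associE st); apply: eqmor_eqhom.
by rewrite mat_tens_pair mat_tens_pair.
Qed.

Variable c : forall a b : C, hom (a ⊗ b) (b ⊗ a).

(** The objects [a] and [b] are left free because in the hexagons [f] or [g] is
    itself a tensor product, whose value at a pair is only propositionally a
    tensor product in [C]. *)
Lemma concentrated_braid f g (x : dom f) (y : dom g) (a b : C) :
  f x = a -> g y = b ->
  concentrated (mat_braid γ c f g) (ipair γ x y) (ipair γ y x) (c a b).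
Proof.
move=> fa gb; split=> [|w wyx]; last first.
  by apply: braid_entry0; rewrite (c1_pair γ_bij) (c2_pair γ_bij).
rewrite /= /braid_entry.
set D := fun e => _; have [|e ->] := delta1 D _.
  by rewrite !(c1_pair γ_bij, c2_pair γ_bij).
apply: eqmor_trans (eqmor_eqhoml _ _) _; apply: eqmor_braid.
  by rewrite c1_pair.
by rewrite c2_pair.
Qed.

Hypothesis cB : braiding c.

Lemma mat_braid_iso f g : @is_iso (matcat C S0) _ _ (mat_braid γ c f g).
Proof.
pose swap h k (p : dom (mat_tens M γ h k)) : dom (mat_tens M γ k h) :=
  ipair γ (c2 p) (c1 p).
have swapK h k : cancel (@swap h k) (@swap k h).
  by move=> p; rewrite /swap (c1_pair γ_bij) (c2_pair γ_bij) pairK.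
apply: monomial_iso (@swapK f g) (@swapK g f) _ _; last exact: braid_entry0.
move=> p; have := concentrated_braid (erefl (f (c1 p))) (erefl (g (c2 p))).
rewrite pairK => -[E _].
exact: eqmor_iso E (braid_iso cB _ _).
Qed.

(** Column [(y',x')] of [C_{f',g'}] is zero except in row [(x',y')], so the
    left-hand side too has a single summand even though [F ⊗ G] may have many
    nonzero entries in row [(x,y)]. *)
Lemma mat_braid_nat f f' g g' (F : mathom f f') (G : mathom g g') :
  mat_comp (mat_braid γ c f' g') (mat_tensm γ Mab F G) =
  mat_comp (mat_tensm γ Mab G F) (mat_braid γ c f g).
Proof.
apply: mathom_ext; apply: pair_ind => x y; apply: pair_ind => y' x'.
have [Cxy C0] := concentrated_braid (erefl (f x)) (erefl (g y)).
have [Cxy' _] := concentrated_braid (erefl (f' x')) (erefl (g' y')).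
rewrite (comp_row _ _ C0).
rewrite (@comp_col _ _ _ _ _ _ _ _ _
  (ipair γ x' y' : dom (mat_tens M γ f' g'))); last first.
  apply: pair_ind => u v uv; apply: braid_entry0 => E; apply: uv.
  move: E; rewrite (c1_pair γ_bij) (c2_pair γ_bij) => E.
  have := congr1 (@c1 _ _ _ _) E; have := congr1 (@c2 _ _ _ _) E.
  by rewrite !(c1_pair γ_bij, c2_pair γ_bij) => -> ->.
apply: eqmorP; apply: eqmor_trans (eqmor_comp Cxy' (tensm_pair F G _ _ _ _)) _.
rewrite (braid_nat cB); apply: eqmor_sym.
exact: eqmor_comp (tensm_pair G F _ _ _ _) Cxy.
Qed.

(** In both matrices row [((x,y),z)] is concentrated at [(y,(z,x))]; the values
    there are the two sides of the hexagon for [c], so after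
    rewriting by it the same value serves for both matrices. *)
Lemma mat_hexagon1 f g h :
  mat_comp (mat_comp (mat_assoc γ st g h f) (mat_braid γ c f (mat_tens M γ g h)))
           (mat_assoc γ st f g h) =
  mat_comp (mat_comp (mat_tensm γ Mab (mat_id g) (mat_braid γ c f h))
                     (mat_assoc γ st g f h))
           (mat_tensm γ Mab (mat_braid γ c f g) (mat_id h)).
Proof.
apply: concentrated_eq; apply: pair_ind => p z; move: p.
apply: pair_ind => x y.
exists (ipair γ y (ipair γ z x)); do 3 eexists; split.
  apply: concentrated_comp; first exact: concentrated_assoc.
  apply: concentrated_comp; last exact: concentrated_assoc.
  by apply: concentrated_braid; rewrite ?mat_tens_pair.
rewrite (hexagon1 cB).
apply: concentrated_comp.
  by apply: concentrated_tens; [exact: concentrated_braid|exact: concentrated_id].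
apply: concentrated_comp; first exact: concentrated_assoc.
by apply: concentrated_tens; [exact: concentrated_id|exact: concentrated_braid].
Qed.

Lemma mat_hexagon2 f g h :
  mat_comp (mat_comp (mat_associ γ st h f g) (mat_braid γ c (mat_tens M γ f g) h))
           (mat_associ γ st f g h) =
  mat_comp (mat_comp (mat_tensm γ Mab (mat_braid γ c f h) (mat_id g))
                     (mat_associ γ st f h g))
           (mat_tensm γ Mab (mat_id f) (mat_braid γ c g h)).
Proof.
apply: concentrated_eq; apply: pair_ind => x; apply: pair_ind => y z.
exists (ipair γ (ipair γ z x) y); do 3 eexists; split.
  apply: concentrated_comp; first exact: concentrated_associ.
  apply: concentrated_comp; last exact: concentrated_associ.
  by apply: concentrated_braid; rewrite ?mat_tens_pair.
rewrite (hexagon2 cB).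
apply: concentrated_comp.
  by apply: concentrated_tens; [exact: concentrated_id|exact: concentrated_braid].
apply: concentrated_comp; first exact: concentrated_associ.
by apply: concentrated_tens; [exact: concentrated_braid|exact: concentrated_id].
Qed.

End TensorRows.

Theorem proposition1p9 (C : abCategory) (M : monoidal C)
    (Mab : monoidal_ab M) (st : strict M)
    (c : forall a b : C, hom (a ⊗ b) (b ⊗ a)) (cB : braiding c)
    (S0 : choiceType) (S0inf : infinite_set [set: S0])
    (γ : S0 * S0 -> S0) (γ_bij : bijective γ) (pt : S0) :
  @braiding (matcat C S0) (matmonoidal pt Mab st γ_bij) (mat_braid γ c).
Proof.
split.
- by move=> f g; exact: mat_braid_iso.
- by move=> f f' g g' F G; exact: mat_braid_nat.
- by move=> f g h; exact: mat_hexagon1.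
- by move=> f g h; exact: mat_hexagon2.
Qed.
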